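(* Let $G$ be a digraph with no loops and no multiple arcs, with vertex set $V(G)=\{v_1,\ldots,v_n\}$ and arc set $E(G)$ of size $m$. Let $A$ be its adjacency matrix and $D$ its in-degree diagonal matrix, and define \[ f_1(G;x)=\det(xI-A),\quad f_2(G;x)=\det(xI-D+A),\quad f_3(G;x)=\det(xI-D-A), \] \[ f_4(G;x)={\rm per}(xI-A),\quad f_5(G;x)={\rm per}(xI-D+A),\quad f_6(G;x)={\rm per}(xI-D-A). \] Then for every $1\leq i\leq 6$, \[ (m-n)f_i(G;x)+x f_i'(G;x)=\sum_{e\in E(G)}f_i(G-e;x), \] where $f_i'$ denotes the derivative with respect to $x$.
   Context: For a digraph $G$ on vertices $v_1,\ldots,v_n$, the adjacency matrix is $A=(a_{ij})_{n\times n}$ with $a_{ij}=1$ if $(v_i,v_j)$ is an arc and $a_{ij}=0$ otherwise; the in-degree diagonal matrix is $D=\mathrm{diag}(d^+(v_1),\ldots,d^+(v_n))$, where $d^+(v_i)$ is the number of arcs with head $v_i$. For an arc $e$, $G-e$ is the digraph on the same vertex set with arc set $E(G)\setminus\{e\}$, and $f_i(G-e;x)$ is defined using the adjacency and in-degree matrices of $G-e$. $I$ is the $n\times n$ identity matrix and ${\rm per}$ denotes the permanent, ${\rm per}(Y)=\sum_{\alpha\in S_n}\prod_{k=1}^n y_{k\alpha(k)}$. *)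

(* Defs.v *)
From mathcomp Require Import all_boot all_order all_fingroup all_algebra.

Set Implicit Arguments.
Unset Strict Implicit.
Unset Printing Implicit Defensive.

Import GRing.Theory.

Local Open Scope ring_scope.

(* A digraph without multiple arcs on the vertices 'I_n, given by its set of
   arcs; (u, v) is the arc with tail u and head v. *)
Definition digraph (n : nat) := {set 'I_n * 'I_n}.

Definition loopless (n : nat) (G : digraph n) : Prop :=
  forall v : 'I_n, (v, v) \notin G.

Definition del_arc (n : nat) (G : digraph n) (e : 'I_n * 'I_n) : digraph n :=
  G :\ e.

Definition indegree (n : nat) (G : digraph n) (v : 'I_n) : nat :=
  #|[set e in G | e.2 == v]|.

Definition adj_mx (n : nat) (G : digraph n) : 'M[int]_n :=
  \matrix_(i, j) ((i, j) \in G)%:R.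

Definition indeg_mx (n : nat) (G : digraph n) : 'M[int]_n :=
  diag_mx (\row_i (indegree G i)%:R).

Definition permanent (R : comNzRingType) (n : nat) (Y : 'M[R]_n) : R :=
  \sum_(s : 'S_n) \prod_(k < n) Y k (s k).

Section GraphPolynomials.

Variables (n : nat) (G : digraph n).

Let xI : 'M[{poly int}]_n := 'X%:M.
Let A : 'M[{poly int}]_n := map_mx polyC (adj_mx G).
Let D : 'M[{poly int}]_n := map_mx polyC (indeg_mx G).

Definition f1 : {poly int} := \det (xI - A).
Definition f2 : {poly int} := \det (xI - D + A).
Definition f3 : {poly int} := \det (xI - D - A).
Definition f4 : {poly int} := permanent (xI - A).
Definition f5 : {poly int} := permanent (xI - D + A).
Definition f6 : {poly int} := permanent (xI - D - A).

End GraphPolynomials.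

(* Only the indices 1 <= i <= 6 are meaningful; other values give 0. *)
Definition graph_poly (i n : nat) (G : digraph n) : {poly int} :=
  match i with
  | 1 => f1 G
  | 2 => f2 G
  | 3 => f3 G
  | 4 => f4 G
  | 5 => f5 G
  | 6 => f6 G
  | _ => 0
  end.

(* Main.v *)
(** Both sides are sums over permutations [s], so it suffices to compare the
    terms of one fixed [s]. The arcs contribute additively to the entries of the
    matrix, and an arc with head [v] contributes to column [v] only. Hence, in
    the product of the entries [(k, s k)], deleting an arc with head [s k]
    changes the [k]-th factor only, and summing the changed factor over the [d]
    arcs with this head gives [d - 1] times the old factor plus [x] times its
    derivative. *)
Require Import Defs.
From mathcomp Require Import all_boot all_order all_fingroup all_algebra.

Import GRing.Theory.

Local Open Scope ring_scope.

(** Leibniz rule; [uniq r] ensures that the filter [j != i] drops exactly one factor. *)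
Lemma deriv_prod (R : comNzRingType) (I : eqType) (r : seq I)
    (F : I -> {poly R}) : uniq r ->
  (\prod_(i <- r) F i)^`() =
  \sum_(i <- r) (F i)^`() * \prod_(j <- r | j != i) F j.
Proof.
elim: r => [|k r IHr] /=; first by rewrite !big_nil derivC.
case/andP=> kr /IHr IH; rewrite big_cons derivM IH !big_cons eqxx /=.
congr (_ * _ + _).
  rewrite [LHS]big_seq [RHS]big_seq_cond; apply/eq_bigl => j.
  by case: (eqVneq j k) => [->|_]; rewrite ?(negPf kr) ?andbT.
rewrite mulr_sumr [LHS]big_seq [RHS]big_seq; apply: eq_bigr => i ir.
have ki : k != i by apply: contraNneq kr => ->.
by rewrite big_cons ki mulrCA.
Qed.

(** The share of the arc [e] in the entry [(u, v)] of [a D + b A]: the first summand counts [e]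
    towards the in-degree of its head, the second records adjacency. *)
Definition arc_weight (a b : int) (n : nat) (e : 'I_n * 'I_n) (u v : 'I_n) :
    int :=
  (e.2 == v)%:R * (a * (u == v)%:R + b * (e.1 == u)%:R).

(** The three matrices of the theorem are the cases [(a, b)] = [(0, -1)], [(-1, 1)] and
    [(-1, -1)]. *)
Definition arc_mx (a b : int) (n : nat) (G : digraph n) : 'M[{poly int}]_n :=
  \matrix_(u, v) ('X *+ (u == v) + (\sum_(e in G) arc_weight a b n e u v)%:P).

(** Here [chi] is an arbitrary weight, not necessarily a character: the sign gives the determinant
    and the constant 1 the permanent, so both are treated at once. *)
Definition immanant (R : comNzRingType) (n : nat) (chi : 'S_n -> R)
    (M : 'M[R]_n) : R :=
  \sum_(s : 'S_n) chi s * \prod_(k < n) M k (s k).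

Lemma arc_mxE (a b : int) (n : nat) (G : digraph n) :
  arc_mx a b n G = 'X%:M + map_mx polyC (a *: indeg_mx G + b *: adj_mx G).
Proof.
apply/matrixP => u v; rewrite !mxE; congr (_ + _%:P).
under eq_bigr do rewrite /arc_weight mulrDr !(mulrCA _ a) !(mulrCA _ b).
rewrite big_split -!mulr_sumr -mulr_suml /=; congr (_ * _ + _ * _).
  rewrite -[RHS]mulr_natr /indegree.
  have [->|_] := eqVneq u v; last by rewrite !mulr0.
  rewrite !mulr1 -sum1_card natr_sum.
  under [RHS]eq_bigl do rewrite inE.
  by rewrite [RHS]big_mkcondr; apply: eq_bigr => e _; case: eqP.
(* With no multiple arcs, head [v] and tail [u] determine the arc, so at most one term survives. *)
rewrite (eq_bigr (fun e => (e == (u, v))%:R)); last first.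
  by case=> x y _; rewrite -natrM mulnb andbC.
case: (boolP ((u, v) \in G)) => uvG.
  rewrite (big_setD1 _ uvG) /= eqxx big1 ?addr0 // => e.
  by rewrite !inE => /andP[/negPf-> _].
by rewrite big1 // => e eG; rewrite (negPf (memPn uvG e eG)).
Qed.

Lemma arc_mx_del (a b : int) (n : nat) (G : digraph n) (e : 'I_n * 'I_n)
    (u v : 'I_n) : e \in G ->
  arc_mx a b n (del_arc G e) u v =
  arc_mx a b n G u v - (arc_weight a b n e u v)%:P.
Proof.
move=> eG; rewrite !mxE (big_setD1 e eG) /= polyCD -addrA; congr (_ + _).
by rewrite addrAC subrr add0r.
Qed.

Lemma arc_mx_del_neq (a b : int) (n : nat) (G : digraph n) (e : 'I_n * 'I_n)
    (u v : 'I_n) : e \in G -> e.2 != v ->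
  arc_mx a b n (del_arc G e) u v = arc_mx a b n G u v.
Proof.
by move=> eG ev; rewrite arc_mx_del // /arc_weight (negPf ev) mul0r subr0.
Qed.

(** The arcs with head [v] together carry the whole constant term of the entry. Deleting each once
    thus subtracts that constant term once in total, and it equals the entry minus its part in ['X],
    which is ['X] times the derivative. *)
Lemma sum_arc_mx_del (a b : int) (n : nat) (G : digraph n) (u v : 'I_n) :
  \sum_(e in G | e.2 == v) arc_mx a b n (del_arc G e) u v =
  arc_mx a b n G u v *+ #|[set e in G | e.2 == v]| - arc_mx a b n G u v
  + 'X * (arc_mx a b n G u v)^`().
Proof.
under eq_bigr => e /andP[eG _] do rewrite arc_mx_del //.
rewrite sumrB -addrA; congr (_ + _).
  by rewrite -sumr_const; apply: eq_bigl => e; rewrite inE.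
have -> : 'X * (arc_mx a b n G u v)^`() = 'X *+ (u == v).
  by rewrite mxE derivD derivC addr0 derivMn derivX mulrnAr mulr1.
rewrite -raddf_sum mxE opprD addrAC addNr add0r; congr (- _%:P).
rewrite [RHS](bigID (fun e => e.2 == v)) /= [X in _ + X]big1 ?addr0 //.
by move=> e /andP[_ /negPf ev]; rewrite /arc_weight ev mul0r.
Qed.

Lemma sum_immanant_del (a b : int) (n : nat) (G : digraph n)
    (chi : 'S_n -> int) :
  let f H := immanant _ n (fun s => (chi s)%:P) (arc_mx a b n H) in
  (#|G|%:Z - n%:Z) *: f G + 'X * (f G)^`() = \sum_(e in G) f (del_arc G e).
Proof.
rewrite /immanant /= [X in _ + _ * X]raddf_sum mulr_sumr scaler_sumr.
rewrite -big_split exchange_big /=.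
apply: eq_bigr => s _; rewrite -mulr_sumr derivM derivC mul0r add0r scalerAr.
rewrite mulrCA -mulrDr.
congr (_ * _); rewrite deriv_prod ?index_enum_uniq //.
(* Group the arcs by the row [k] whose factor lies in the column of their head. *)
rewrite [RHS](partition_big (fun e => (s^-1)%g e.2) predT) //=.
set M := arc_mx a b n G; set P := \prod_k _.
have PE k : P = M k (s k) * \prod_(j | j != k) M j (s j).
  by rewrite /P (bigD1 k).
have headE k e : ((s^-1)%g e.2 == k) = (e.2 == s k).
  by rewrite -(inj_eq (@perm_inj _ s)) permKV.
(* For each [k], the single-entry identity is multiplied by the product of the other factors, which
   turns the entry itself back into [P]. *)
transitivity (\sum_k (P *+ #|[set e in G | e.2 == s k]| - P +
    'X * ((M k (s k))^`() * \prod_(j | j != k) M j (s j)))); last first.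
  apply: eq_bigr => k _; under [RHS]eq_bigl do rewrite headE.
  rewrite [RHS](eq_bigr (fun e => arc_mx a b n (del_arc G e) k (s k) *
      \prod_(j | j != k) M j (s j))).
    by rewrite -mulr_suml sum_arc_mx_del !mulrDl mulNr mulrnAl -PE mulrA.
  move=> e /andP[eG /eqP ek]; rewrite (bigD1 k) //=; congr (_ * _).
  apply: eq_bigr => j jk; apply: arc_mx_del_neq => //.
  by rewrite ek (inj_eq perm_inj) eq_sym.
rewrite big_split -mulr_sumr /=; congr (_ + _).
(* The [n] rows contribute [- P] each; it remains to add up the in-degrees. *)
rewrite sumrB sumr_const card_ord sumrMnr scalerBl
  -(natz #|G|) -(natz n) !scaler_nat.
congr (_ *+ _ - _).
(* Every arc has exactly one head and [s] is a bijection, so the in-degrees of the [s k] sum to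
   [#|G|]. *)
rewrite -sum1_card (partition_big (fun e => (s^-1)%g e.2) predT) //=.
apply: eq_bigr => k _; rewrite -sum1_card.
by apply: eq_bigl => e; rewrite inE headE.
Qed.

Lemma sum_det_arc_mx_del (a b : int) (n : nat) (G : digraph n) :
  let f H := \det (arc_mx a b n H) in
  (#|G|%:Z - n%:Z) *: f G + 'X * (f G)^`() = \sum_(e in G) f (del_arc G e).
Proof.
move=> f; have fE H :
    f H = immanant _ n (fun s : 'S_n => ((-1) ^+ s)%:P) (arc_mx a b n H).
  (* The sign in [\det] is a polynomial, whereas [chi] takes integer values. *)
  by apply: eq_bigr => s _; rewrite rmorph_sign.
under [RHS]eq_bigr do rewrite fE.
by rewrite fE (sum_immanant_del _ _ _ _ (fun s : 'S_n => (-1) ^+ s)).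
Qed.

Lemma sum_permanent_arc_mx_del (a b : int) (n : nat) (G : digraph n) :
  let f H := permanent (arc_mx a b n H) in
  (#|G|%:Z - n%:Z) *: f G + 'X * (f G)^`() = \sum_(e in G) f (del_arc G e).
Proof.
move=> f; have fE H : f H = immanant _ n (fun=> 1%:P) (arc_mx a b n H).
  by apply: eq_bigr => s _; rewrite mul1r.
under [RHS]eq_bigr do rewrite fE.
by rewrite fE (sum_immanant_del _ _ _ _ (fun=> 1)).
Qed.

Lemma adj_arc_mx (n : nat) (G : digraph n) :
  'X%:M - map_mx polyC (adj_mx G) = arc_mx 0 (-1) n G.
Proof. by rewrite arc_mxE scale0r add0r scaleN1r map_mxN. Qed.

Lemma laplacian_arc_mx (n : nat) (G : digraph n) :
  'X%:M - map_mx polyC (indeg_mx G) + map_mx polyC (adj_mx G) =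
  arc_mx (-1) 1 n G.
Proof. by rewrite arc_mxE scaleN1r scale1r map_mxD map_mxN addrA. Qed.

Lemma signless_laplacian_arc_mx (n : nat) (G : digraph n) :
  'X%:M - map_mx polyC (indeg_mx G) - map_mx polyC (adj_mx G) =
  arc_mx (-1) (-1) n G.
Proof. by rewrite arc_mxE !scaleN1r map_mxD !map_mxN addrA. Qed.

Theorem theorem3p3 (n : nat) (G : digraph n) (hG : loopless G)
    (i : nat) (hi : (1 <= i <= 6)%N) :
  (#|G|%:Z - n%:Z) *: graph_poly i G + 'X * (graph_poly i G)^`() =
  \sum_(e in G) graph_poly i (del_arc G e).
Proof.
case: i hi => [|[|[|[|[|[|[|i]]]]]]] //= _; rewrite /f1 /f2 /f3 /f4 /f5 /f6.
- under [RHS]eq_bigr do rewrite adj_arc_mx.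
  by rewrite adj_arc_mx sum_det_arc_mx_del.
- under [RHS]eq_bigr do rewrite laplacian_arc_mx.
  by rewrite laplacian_arc_mx sum_det_arc_mx_del.
- under [RHS]eq_bigr do rewrite signless_laplacian_arc_mx.
  by rewrite signless_laplacian_arc_mx sum_det_arc_mx_del.
- under [RHS]eq_bigr do rewrite adj_arc_mx.
  by rewrite adj_arc_mx sum_permanent_arc_mx_del.
- under [RHS]eq_bigr do rewrite laplacian_arc_mx.
  by rewrite laplacian_arc_mx sum_permanent_arc_mx_del.
- under [RHS]eq_bigr do rewrite signless_laplacian_arc_mx.
  by rewrite signless_laplacian_arc_mx sum_permanent_arc_mx_del.
Qed.
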